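(* Let $N$ be a normal subgroup of a finite group $G$. Assume that there are exactly two real $G$-conjugacy classes in $N$. Then $N$ has a normal Sylow $2$-subgroup.
   Context: A $G$-conjugacy class of $N$ is a conjugacy class $x^G$ of $G$ with $x\in N$; it is real if $x^G=(x^{-1})^G$. *)

(* Defs.v *)
From mathcomp Require Import all_boot all_fingroup all_solvable.

Set Implicit Arguments.
Unset Strict Implicit.
Unset Printing Implicit Defensive.

Import GroupScope.

Section RealClasses.

Variables (gT : finGroupType) (G N : {set gT}).

Definition real_Gclasses : {set {set gT}} :=
  [set x ^: G | x in N & x ^: G == x^-1 ^: G].

End RealClasses.

(* Main.v *)
Require Import Defs.
From mathcomp Require Import all_boot all_fingroup all_solvable.

Import GroupScope.

(** A product of two involutions is inverted by each of them, so if no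
    nontrivial element of odd order is real then any two involutions generate a
    2-group, and by the Baer-Suzuki theorem every involution lies in the 2-core.
    The absence of such elements in [N] passes to [N / 'O_2(N)], whose 2-core is
    trivial; so this quotient has odd order, and ['O_2(N)] is a Sylow subgroup.
    When [N] has exactly two real [G]-classes and even order, these are the
    class of [1] and that of an involution, so no nontrivial element of odd
    order in [N] is real. *)

(** Correcting the conjugator by an element of [Q] turns inversion modulo [Q] into true inversion,
    so a nontrivial real element of odd order in [N / 'O_2(N)] would yield one in [N]. *)
Lemma lift_inverted_p'elt (gT : finGroupType) (p : nat) (Q : {group gT})
    (x g : gT) :
  p.-group Q -> p^'.-elt x -> x \in 'N(Q) -> g \in 'N(Q) ->
  coset Q x ^ coset Q g = (coset Q x)^-1 ->
  exists2 n, n \in Q & x ^ (g * n) = x^-1.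
Proof.
move=> pQ p'x Nx Ng xg_inv.
have coQx: coprime #|Q| #|<[x]>| by apply: pnat_coprime pQ _.
have nQx: <[x]> \subset 'N(Q) by rewrite cycle_subG.
have sxgQx: <[x]> :^ g \subset Q * <[x]>.
  have NX: x ^ g \in 'N(Q) by rewrite groupJ.
  rewrite -cycleJ -norm_joinEr // cycle_subG /= norm_joinEr //.
  have: x ^ g \in Q :* x^-1.
    by apply/rcoset_kercosetP; rewrite ?groupV // morphJ // morphV.
  by apply: subsetP; rewrite mulgS // sub1set groupV cycle_id.
(* Complements of [Q] in [Q * <[x]>] are conjugate under [Q], so the conjugator
   can be corrected to normalise [<[x]>], which meets [Q] trivially. *)
have [n Qn xgE] := SchurZassenhaus_trans_sol (pgroup_sol pQ) nQx sxgQx coQx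
  (cardJg _ g).
exists n^-1; first by rewrite groupV.
have xgn: x ^ (g * n^-1) \in <[x]>.
  rewrite conjgM -mem_conjg -xgE memJ_conjg; exact: cycle_id.
(* The product [x * x ^ (g * n^-1)] lies in [<[x]>] and is trivial modulo [Q], so by coprimality it
   is 1. *)
apply/eqP; rewrite eq_sym eq_mulVg1 invgK -in_set1 -set1gE -(coprime_TIg coQx).
have Nn: n \in 'N(Q) by apply: subsetP Qn; apply: normG.
have Ngn: g * n^-1 \in 'N(Q) by rewrite groupM ?groupV.
apply/setIP; split; last by rewrite groupM ?cycle_id.
apply: coset_idr; first by rewrite groupM ?groupJ.
rewrite morphM ?groupJ // morphJ // (morphM _ Ng) ?groupV // morphV //.
by rewrite /= (coset_id Qn) invg1 mulg1 xg_inv mulgV.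
Qed.

Lemma pcore2_Sylow_of_no_real_odd (gT : finGroupType) (N : {group gT}) :
    {in N &, forall x g, 2^'.-elt x -> x ^ g = x^-1 -> x = 1} ->
  2.-Sylow(N) 'O_2(N).
Proof.
move=> noreal; rewrite /pHall pcore_sub pcore_pgroup /=.
have nQN: N \subset 'N('O_2(N)) := normal_norm (pcore_normal 2 N).
rewrite -card_quotient // p'natE //; apply/negP=> /Cauchy[] // t Nt ot.
suff: t \in 'O_2(N / 'O_2(N)).
  by rewrite trivg_pcore_quotient => /set1P t1; rewrite t1 order1 in ot.
apply: (Baer_Suzuki Nt) => y Ny.
set c := t * t ^ y.
have tt: t * t = 1 by rewrite -(expg_order t) ot.
have tV: t^-1 = t by apply/eqP; rewrite eq_invg_mul tt.
have ct: c ^ t = c^-1.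
  by rewrite /c invMg -conjVg tV conjgE tV mulgA (mulgA t t) tt mul1g.
have Nc: c \in N / 'O_2(N) by rewrite groupM ?groupJ.
have c2'1: c.`_2^' = 1.
  (* [t] also inverts the odd part of [c], which lifts to the odd part of a preimage [x] of [c] in
     [N]. *)
  have zt: c.`_2^' ^ t = (c.`_2^')^-1 by rewrite -consttJ ct consttV.
  have [x Nqx Nx xE] := morphimP Nc.
  have [g Nqg Ng gE] := morphimP Nt.
  have zE: c.`_2^' = coset 'O_2(N) x.`_2^' by rewrite morph_constt // -xE.
  have Nz: x.`_2^' \in N by rewrite groupX.
  have Nqz := subsetP nQN _ Nz.
  rewrite zE gE in zt.
  have [n Qn] := lift_inverted_p'elt _ _ _ _ _ (pcore_pgroup 2 N)
    (p_elt_constt _ x) Nqz Nqg zt.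
  move/noreal=> z1; rewrite zE z1 ?morph1 ?p_elt_constt // groupM //.
  exact: subsetP (pcore_sub 2 N) n Qn.
have c2: 2.-elt c by rewrite -(consttC 2 c) c2'1 mulg1 p_elt_constt.
(* As [c] is a 2-element, [<[c]> <*> <[t]>] is a 2-group; it contains [t ^ y = t^-1 * c]. *)
have nct: <[t]> \subset 'N(<[c]>).
  rewrite cycle_subG; apply/normP; rewrite -cycleJ ct; exact: cycleV.
have sDct: <<[set t; t ^ y]>> \subset <[c]> <*> <[t]>.
  have Ht: t \in <[c]> <*> <[t]> by rewrite mem_gen // inE cycle_id orbT.
  rewrite gen_subG subUset !sub1set Ht /= -(mulKg t (t ^ y)) groupM ?groupV //.
  by rewrite mem_gen // inE cycle_id.
apply: (pgroupS sDct).
by rewrite /= norm_joinEr // pgroupM /pgroup -!orderE ot andbT.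
Qed.

Theorem corollary5p7 (gT : finGroupType) (G N : {group gT})
    (nsNG : N <| G) (two_real : #|real_Gclasses G N| = 2) :
  exists P : {group gT}, 2.-Sylow(N) P /\ P <| N.
Proof.
exists 'O_2(N)%G; split; last exact: pcore_normal.
have [evN | oddN] := boolP (2 %| #|N|); last first.
  rewrite /pHall pcore_sub pcore_pgroup.
  by rewrite (pnat_dvd (dvdn_indexg _ _)) // p'natE.
have [t Nt ot] := Cauchy (isT : prime 2) evN.
apply: pcore2_Sylow_of_no_real_odd => x g Nx Ng odd_x xg.
apply/eqP; apply: contraT => nx1.
(* Element orders separate the classes of [1], [t] and [x], giving three real classes against
   [two_real]. *)
have class_order (a b : gT) : a ^: G = b ^: G -> #[a] = #[b].
  by move=> /class_eqP/imsetP[h _ ->]; rewrite orderJ.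
have real1: 1 ^: G \in real_Gclasses G N.
  by apply/imsetP; exists 1; rewrite // !inE group1 invg1 /=.
have realt: t ^: G \in real_Gclasses G N.
  apply/imsetP; exists t; rewrite // !inE Nt /= (_ : t^-1 = t) //.
  by apply/eqP; rewrite eq_invg_mul -(expg_order t) ot.
have realx: x ^: G \in real_Gclasses G N.
  apply/imsetP; exists x; rewrite // !inE Nx -xg /= classGidl //.
  exact: subsetP (normal_sub nsNG) g Ng.
have ne_t1: t ^: G != 1 ^: G.
  by apply/eqP=> /class_order; rewrite ot order1.
have ne_x1: x ^: G != 1 ^: G.
  by apply: contra nx1 => /eqP/class_order/eqP; rewrite order1 order_eq1.
have ne_xt: x ^: G != t ^: G.
  by apply/eqP=> /class_order ox; rewrite /p_elt ox ot in odd_x.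
have: [set x ^: G; t ^: G; 1 ^: G] \subset real_Gclasses G N.
  by rewrite !subUset !sub1set realx realt real1.
move/subset_leq_card.
by rewrite two_real setUC cardsU1 !inE cards2 ne_xt eq_sym (negPf ne_x1)
  eq_sym (negPf ne_t1).
Qed.
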